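(* Let $G$ be a group, $N$ a normal subgroup of $G$, and $H_1,H_2\subseteq G$ subsets with $N\subseteq H_i$ for $i=1,2$. Then: (1) $\overline{\operatorname{Apr}}_{G/N}((H_1\cap H_2)/N)\subseteq \overline{\operatorname{Apr}}_{G/N}((H_1/N)\cap (H_2/N))\subseteq \overline{\operatorname{Apr}}_{G/N}(H_1/N)\cap \overline{\operatorname{Apr}}_{G/N}(H_2/N)$. (2) $\underline{\operatorname{Apr}}_{G/N}((H_1\cap H_2)/N)\subseteq \underline{\operatorname{Apr}}_{G/N}((H_1/N)\cap (H_2/N))= \underline{\operatorname{Apr}}_{G/N}(H_1/N)\cap \underline{\operatorname{Apr}}_{G/N}(H_2/N)$.
   Context: Let $G$ be a group (written multiplicatively) and $N$ a normal subgroup of $G$. For a subset $H\subseteq G$ with $N\subseteq H$ (not necessarily a subgroup), $H/N:=\{hN : h\in H\}\subseteq G/N$. The relation $\theta$ on $G/N$ is conjugacy: $xN\,\theta\, yN$ iff $xN=(aya^{-1})N$ for some $a\in G$; the class of $xN$ is $[xN]_\theta=\{(axa^{-1})N : a\in G\}$. For a subset $S\subseteq G/N$, the lower and upper approximations are $\underline{\operatorname{Apr}}_{G/N}(S)=\{xN\in G/N : [xN]_\theta\subseteq S\}$ and $\overline{\operatorname{Apr}}_{G/N}(S)=\{xN\in G/N : [xN]_\theta\cap S\neq\varnothing\}$. *)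

(* Defs.v *)
From HB Require Import structures.
From mathcomp Require Import all_boot.
From mathcomp Require Import boolp classical_sets.

Set Implicit Arguments.
Unset Strict Implicit.
Unset Printing Implicit Defensive.

Local Open Scope group_scope.
Local Open Scope classical_set_scope.

Section RoughQuotient.
Variable G : groupType.
Implicit Types (N H : set G) (X Y : set G) (S : set (set G)).

Definition normal_subgroup N : Prop :=
  group_closed [in N] /\ forall g n, N n -> N (g * n * g^-1).

Definition lcoset N (x : G) : set G := [set x * n | n in N].

(* An element of G / N is a coset, i.e. a set of elements of G, so a subset of
   G / N is a set of sets. *)
Definition quotient H N : set (set G) := [set lcoset N h | h in H].

Definition theta N X Y : Prop :=
  exists x y, [/\ X = lcoset N x, Y = lcoset N y
    & exists a, lcoset N x = lcoset N (a * y * a^-1)].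

Definition theta_class N X : set (set G) := [set Y | theta N Y X].

Definition lower_apr N S : set (set G) :=
  [set X | quotient [set: G] N X /\ theta_class N X `<=` S].

Definition upper_apr N S : set (set G) :=
  [set X | quotient [set: G] N X /\ theta_class N X `&` S !=set0].

Lemma eq_lcosetP N x y : normal_subgroup N ->
  lcoset N x = lcoset N y <-> N (x^-1 * y).
Proof.
move=> [NG _]; have [N1 _] := NG.
have NM u v : N u -> N v -> N (u * v).
  by move=> /mem_set uN /mem_set vN; apply/set_mem/(group_closedM NG).
have NV u : N u -> N u^-1.
  by move=> /mem_set uN; apply/set_mem/(group_closedV NG).
split=> [exy|Nxy].
  have : lcoset N y y by exists 1; [exact/set_mem | rewrite mulg1].
  by rewrite -exy => -[n Nn <-]; rewrite mulKg.
apply/seteqP; split=> _ [n Nn <-].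
  exists ((x^-1 * y)^-1 * n); first exact/NM/Nn/NV.
  by rewrite invgM invgK !mulgA mulgV mul1g.
by exists (x^-1 * y * n); [exact: NM | rewrite !mulgA mulgV mul1g].
Qed.

(* For normal N the class of xN does not depend on the representative x. *)
Lemma theta_class_lcoset N x : normal_subgroup N ->
  theta_class N (lcoset N x) = [set lcoset N (a * x * a^-1) | a in [set: G]].
Proof.
move=> nN; apply/seteqP; split=> [Y [y [z [-> exz [a ->]]]]|_ [a _ <-]]; last first.
  by exists (a * x * a^-1), x; split=> //; exists a.
exists a => //; apply/eq_lcosetP => //.
move/(eq_lcosetP _ _ nN): exz => /(nN.2 a).
by rewrite !invgM invgK !mulgA mulgVK.
Qed.

End RoughQuotient.

(* Main.v *)
Require Import Defs.
From mathcomp Require Import all_boot.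
From mathcomp Require Import boolp classical_sets.

(** Both approximation operators are monotone in the approximated set of
    cosets. As the image of an intersection lies in the intersection of the
    images, monotonicity gives the first inclusion of each part; it also makes
    the upper approximation of an intersection lie in that of each factor. The
    lower approximation asks for the whole conjugacy class to lie in the set,
    and a class lies in an intersection exactly when it lies in both factors:
    hence the equality. For the upper approximation the class may meet the two
    factors in different cosets, so that only an inclusion remains. *)

Local Open Scope classical_set_scope.

Lemma upper_apr_subset (G : groupType) (N : set G) (S T : set (set G)) :
  S `<=` T -> upper_apr N S `<=` upper_apr N T.
Proof.
by move=> sST X [GX [Y [XY SY]]]; split=> //; exists Y; split=> //; apply: sST.
Qed.

Lemma lower_apr_subset (G : groupType) (N : set G) (S T : set (set G)) :
  S `<=` T -> lower_apr N S `<=` lower_apr N T.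
Proof. by move=> sST X [GX sXS]; split=> //; apply: subset_trans sST. Qed.

Lemma lower_aprI (G : groupType) (N : set G) (S T : set (set G)) :
  lower_apr N (S `&` T) = lower_apr N S `&` lower_apr N T.
Proof.
apply/seteqP; split=> [X [GX]|X [[GX sXS] [_ sXT]]].
  by rewrite subsetI => -[sXS sXT]; split; split.
by split=> //; rewrite subsetI.
Qed.

Lemma quotientI_subset (G : groupType) (N H1 H2 : set G) :
  quotient (H1 `&` H2) N `<=` quotient H1 N `&` quotient H2 N.
Proof. exact: sub_image_setI. Qed.

Theorem proposition2p8 (G : groupType) (N H1 H2 : set G)
    (hN : normal_subgroup N) (hH1 : N `<=` H1) (hH2 : N `<=` H2) :
  (upper_apr N (quotient (H1 `&` H2) N)
     `<=` upper_apr N (quotient H1 N `&` quotient H2 N) /\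
   upper_apr N (quotient H1 N `&` quotient H2 N)
     `<=` upper_apr N (quotient H1 N) `&` upper_apr N (quotient H2 N)) /\
  (lower_apr N (quotient (H1 `&` H2) N)
     `<=` lower_apr N (quotient H1 N `&` quotient H2 N) /\
   lower_apr N (quotient H1 N `&` quotient H2 N)
     = lower_apr N (quotient H1 N) `&` lower_apr N (quotient H2 N)).
Proof.
split; split.
- exact/upper_apr_subset/quotientI_subset.
- rewrite subsetI; split; apply: upper_apr_subset.
    exact: subIsetl.
  exact: subIsetr.
- exact/lower_apr_subset/quotientI_subset.
- exact: lower_aprI.
Qed.
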